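(* The system $\mathsf{RCA}_0^\omega$ proves the implication $\mathsf{Rado}(\mathbb{N}^{\mathbb{N}})\rightarrow\mathsf{BOOT}$, where $\mathsf{BOOT}$ is the statement $(\forall Y^{2})(\exists X^{1})(\forall n^{0})\big[ n\in X \leftrightarrow (\exists f^{1})(Y(f, n)=0)\big]$, and $\mathsf{Rado}(\mathbb{N}^{\mathbb{N}})$ is the following statement: let $A_i$ be a collection of (non-empty) finite subsets of $\mathbb{N}$ indexed by $i\in\mathbb{N}^{\mathbb{N}}$ and, for any finite set $J\subset\mathbb{N}^{\mathbb{N}}$, let $F_J^2$ be a choice function for the collection $A_j$, $j\in J$. Then there is a choice function $F^2$ for the entire collection $A_j$, $j\in\mathbb{N}^{\mathbb{N}}$, such that for all finite $J\subset\mathbb{N}^{\mathbb{N}}$ there is a finite $K\supseteq J$ such that $F(j)=_0F_K(j)$ for all $j\in J$.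
   Context: Finite types: $0$ is a type (natural numbers), and if $\sigma,\tau$ are types, so is $\sigma\to\tau$; $1\equiv 0\to 0$ and $n+1\equiv n\to 0$. Superscripts indicate types. Type $1$ objects are elements of $\mathbb{N}^{\mathbb{N}}$, type $2$ objects are functionals $\mathbb{N}^{\mathbb{N}}\to\mathbb{N}$. $\rho^{*}$ is the type of finite sequences of type $\rho$ objects; pairs and finite sequences are coded as usual. $\mathsf{L}_\omega$ is the language with variables of every finite type, constants $0,1,<_0,+_0,\times_0,=_0$, the combinators $\Pi,\Sigma$ and the recursor $\mathbf{R}_0$. For $\tau=(\tau_1\to\dots\to\tau_k\to 0)$, $x=_\tau y$ means $(\forall z_1^{\tau_1}\dots z_k^{\tau_k})(xz_1\dots z_k=_0 yz_1\dots z_k)$. The system $\mathsf{RCA}_0^\omega$ has the axioms: (a) $0,1,<_0,+_0,\times_0$ form an ordered semi-ring with equality $=_0$; (b) the defining axioms of the combinators $\Pi,\Sigma$ (giving $\lambda$-abstraction); (c) $\mathbf{R}_0(f^1,m^0,0)=m$ and $\mathbf{R}_0(f,m,n+1)=f(n,\mathbf{R}_0(f,m,n))$; (d) extensionality: $(\forall x^\rho,y^\rho,\varphi^{\rho\to\tau})(x=_\rho y\to\varphi(x)=_\tau\varphi(y))$ for all types $\rho,\tau$; (e) induction for quantifier-free formulas of $\mathsf{L}_\omega$; (f) $\mathsf{QF}\text{-}\mathsf{AC}^{1,0}$, where $\mathsf{QF}\text{-}\mathsf{AC}^{\sigma,\tau}$ is $(\forall x^\sigma)(\exists y^\tau)A(x,y)\to(\exists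 Y^{\sigma\to\tau})(\forall x^\sigma)A(x,Y(x))$ for quantifier-free $A$ of $\mathsf{L}_\omega$. Subsets $X$ of $\mathbb{N}$ are given by characteristic functions of type $1$. A choice function $f$ for a collection of non-empty sets $A_i$ indexed by $I$ is such that $f(i)\in A_i$ for all $i\in I$. A collection of finite subsets of $\mathbb{N}$ indexed by $\mathbb{N}^{\mathbb{N}}$ is given by a mapping $Y^{1\to0^*}$ (sending an index to a finite sequence of numbers representing a finite set). Finite subsets of $\mathbb{N}^{\mathbb{N}}$ are given by finite sequences of type $1^*$, and the family $F_J^2$ is given as a functional of $J$. *)

(* Defs.v *)
From Stdlib Require Import List.
Import ListNotations.

Set Implicit Arguments.
Unset Strict Implicit.
Unset Printing Implicit Defensive.

Inductive ty : Type :=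
| N : ty
| Arr : ty -> ty -> ty.

Notation "s ⇒ t" := (Arr s t) (at level 55, right associativity).

Notation ty1 := (N ⇒ N).
Notation ty2 := (ty1 ⇒ N).

(** Terms and formulas are intrinsically typed, with de Bruijn variables over a
    context listing the types of the free variables, innermost binder first.
    There is no term binder: functions are built from the combinators. *)
Definition ctx := list ty.

Inductive var : ctx -> ty -> Type :=
| vz : forall (G : ctx) (s : ty), var (s :: G) s
| vs : forall (G : ctx) (s t : ty), var G t -> var (s :: G) t.

Arguments vz {G s}.
Arguments vs {G s t} _.

Inductive tm (G : ctx) : ty -> Type :=
| Var : forall t, var G t -> tm G t
| App : forall s t, tm G (s ⇒ t) -> tm G s -> tm G t
| Zero : tm G N
| One : tm G N
| Plus : tm G (N ⇒ N ⇒ N)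
| Times : tm G (N ⇒ N ⇒ N)
| Pi : forall s t, tm G (s ⇒ t ⇒ s)
| Sigma : forall r s t, tm G ((r ⇒ s ⇒ t) ⇒ (r ⇒ s) ⇒ r ⇒ t)
| Rec : tm G ((N ⇒ N ⇒ N) ⇒ N ⇒ N ⇒ N).

Arguments Var {G t} _.
Arguments App {G s t} _ _.
Arguments Zero {G}.
Arguments One {G}.
Arguments Plus {G}.
Arguments Times {G}.
Arguments Pi {G} s t.
Arguments Sigma {G} r s t.
Arguments Rec {G}.

Notation v0 := (Var vz).
Notation v1 := (Var (vs vz)).
Notation v2 := (Var (vs (vs vz))).
Notation v3 := (Var (vs (vs (vs vz)))).
Notation v4 := (Var (vs (vs (vs (vs vz))))).

Declare Scope tm_scope.
Delimit Scope tm_scope with tm.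
Bind Scope tm_scope with tm.
Notation "f · a" := (App f a) (at level 25, left associativity) : tm_scope.
Notation "a + b" := (App (App Plus a) b) : tm_scope.
Notation "a * b" := (App (App Times a) b) : tm_scope.
Notation "0" := Zero : tm_scope.
Notation "1" := One : tm_scope.
Open Scope tm_scope.

(** The only prime formulas are those for [=_0] and [<_0]. *)
Inductive fm : ctx -> Type :=
| Eq : forall G, tm G N -> tm G N -> fm G
| Lt : forall G, tm G N -> tm G N -> fm G
| Bot : forall G, fm G
| Imp : forall G, fm G -> fm G -> fm G
| And : forall G, fm G -> fm G -> fm G
| Or : forall G, fm G -> fm G -> fm G
| All : forall G (s : ty), fm (s :: G) -> fm G
| Ex : forall G (s : ty), fm (s :: G) -> fm G.

Arguments Bot {G}.
Arguments All {G} s _.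
Arguments Ex {G} s _.

Declare Scope fm_scope.
Delimit Scope fm_scope with fm.
Bind Scope fm_scope with fm.
Notation "a ≐ b" := (Eq a b) (at level 70, no associativity) : fm_scope.
Notation "a ≺ b" := (Lt a b) (at level 70, no associativity) : fm_scope.
Notation "A ⊓ B" := (And A B) (at level 80, right associativity) : fm_scope.
Notation "A ⊔ B" := (Or A B) (at level 85, right associativity) : fm_scope.
Notation "A ⊃ B" := (Imp A B) (at level 90, right associativity) : fm_scope.
Open Scope fm_scope.

Definition Iff G (A B : fm G) : fm G := (A ⊃ B) ⊓ (B ⊃ A).

Fixpoint qf G (A : fm G) : Prop :=
  match A with
  | Eq _ _ | Lt _ _ | Bot => True
  | Imp A B | And A B | Or A B => qf A /\ qf B
  | All _ _ | Ex _ _ => False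
  end.

Definition sub (G D : ctx) := forall t, var G t -> tm D t.

Fixpoint sub_tm G D (e : sub G D) t (a : tm G t) : tm D t :=
  match a with
  | Var x => e _ x
  | App f b => App (sub_tm e f) (sub_tm e b)
  | Zero => Zero
  | One => One
  | Plus => Plus
  | Times => Times
  | Pi s t => Pi s t
  | Sigma r s t => Sigma r s t
  | Rec => Rec
  end.

Definition sid G : sub G G := fun _ x => Var x.
Definition shift G s : sub G (s :: G) := fun _ x => Var (vs x).

Definition scons G D s (a : tm D s) (e : sub G D) : sub (s :: G) D :=
  fun t x =>
    match x in var (s' :: G') t' return tm D s' -> sub G' D -> tm D t' with
    | vz => fun a _ => a
    | vs y => fun _ e => e _ y
    end a e.

Definition wk G s t (a : tm G t) : tm (s :: G) t := sub_tm (@shift G s) a.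

Definition up G D s (e : sub G D) : sub (s :: G) (s :: D) :=
  scons v0 (fun t x => wk s (e t x)).

Fixpoint sub_fm G (A : fm G) : forall D, sub G D -> fm D :=
  match A with
  | Eq a b => fun D e => sub_tm e a ≐ sub_tm e b
  | Lt a b => fun D e => sub_tm e a ≺ sub_tm e b
  | Bot => fun D e => Bot
  | Imp A B => fun D e => sub_fm A e ⊃ sub_fm B e
  | And A B => fun D e => sub_fm A e ⊓ sub_fm B e
  | Or A B => fun D e => sub_fm A e ⊔ sub_fm B e
  | All s A => fun D e => All s (sub_fm A (up e))
  | Ex s A => fun D e => Ex s (sub_fm A (up e))
  end.

Definition wk_fm G s (A : fm G) : fm (s :: G) := sub_fm A (@shift G s).
Definition inst G s (A : fm (s :: G)) (a : tm G s) : fm G :=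
  sub_fm A (scons a (@sid G)).

Arguments wk {G s t} a.
Arguments wk_fm {G s} A.

Fixpoint eqty (t : ty) : forall G, tm G t -> tm G t -> fm G :=
  match t return forall G, tm G t -> tm G t -> fm G with
  | N => fun G x y => x ≐ y
  | s ⇒ t => fun G x y => All s (eqty (wk x · v0) (wk y · v0))
  end.

(** Classical many-sorted natural deduction.
    [Prf Ax H A]: with the formulas over the free variables [G] in [H] as open
    assumptions, [A] is derivable from the axioms [Ax]. *)
Inductive Prf (Ax : forall G, fm G -> Prop) : forall G, list (fm G) -> fm G -> Prop :=
| PAx : forall G (H : list (fm G)) A, Ax G A -> Prf Ax H A
| PHyp : forall G (H : list (fm G)) A, In A H -> Prf Ax H A
| PImpI : forall G (H : list (fm G)) A B, Prf Ax (A :: H) B -> Prf Ax H (A ⊃ B)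
| PImpE : forall G (H : list (fm G)) A B,
    Prf Ax H (A ⊃ B) -> Prf Ax H A -> Prf Ax H B
| PAndI : forall G (H : list (fm G)) A B,
    Prf Ax H A -> Prf Ax H B -> Prf Ax H (A ⊓ B)
| PAndE1 : forall G (H : list (fm G)) A B, Prf Ax H (A ⊓ B) -> Prf Ax H A
| PAndE2 : forall G (H : list (fm G)) A B, Prf Ax H (A ⊓ B) -> Prf Ax H B
| POrI1 : forall G (H : list (fm G)) A B, Prf Ax H A -> Prf Ax H (A ⊔ B)
| POrI2 : forall G (H : list (fm G)) A B, Prf Ax H B -> Prf Ax H (A ⊔ B)
| POrE : forall G (H : list (fm G)) A B C,
    Prf Ax H (A ⊔ B) -> Prf Ax (A :: H) C -> Prf Ax (B :: H) C -> Prf Ax H C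
| PRaa : forall G (H : list (fm G)) A, Prf Ax ((A ⊃ Bot) :: H) Bot -> Prf Ax H A
| PAllI : forall G (H : list (fm G)) s (A : fm (s :: G)),
    Prf Ax (map wk_fm H) A -> Prf Ax H (All s A)
| PAllE : forall G (H : list (fm G)) s (A : fm (s :: G)) (a : tm G s),
    Prf Ax H (All s A) -> Prf Ax H (inst A a)
| PExI : forall G (H : list (fm G)) s (A : fm (s :: G)) (a : tm G s),
    Prf Ax H (inst A a) -> Prf Ax H (Ex s A)
| PExE : forall G (H : list (fm G)) s (A : fm (s :: G)) C,
    Prf Ax H (Ex s A) -> Prf Ax (A :: map wk_fm H) (wk_fm C) -> Prf Ax H C.

Definition provable (Ax : forall G, fm G -> Prop) (A : fm []) : Prop :=
  Prf Ax [] A.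

(** Axioms are stated for arbitrary terms over an arbitrary context of
    parameters, which amounts to their universal closures.  Discreteness of the
    order and [0] being least follow from quantifier-free induction. *)
Inductive RCA0omega : forall G, fm G -> Prop :=
(* congruence for [=_0] of all function symbols is an instance of [ax_ext] *)
| ax_refl : forall G (a : tm G N), RCA0omega (a ≐ a)
| ax_sym : forall G (a b : tm G N), RCA0omega (a ≐ b ⊃ b ≐ a)
| ax_trans : forall G (a b c : tm G N), RCA0omega (a ≐ b ⊃ b ≐ c ⊃ a ≐ c)
| ax_lt_eq : forall G (a a' b b' : tm G N),
    RCA0omega (a ≐ a' ⊃ b ≐ b' ⊃ a ≺ b ⊃ a' ≺ b')
| ax_addA : forall G (a b c : tm G N), RCA0omega (a + (b + c) ≐ a + b + c)
| ax_addC : forall G (a b : tm G N), RCA0omega (a + b ≐ b + a)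
| ax_add0 : forall G (a : tm G N), RCA0omega (a + 0 ≐ a)
| ax_mulA : forall G (a b c : tm G N), RCA0omega (a * (b * c) ≐ a * b * c)
| ax_mulC : forall G (a b : tm G N), RCA0omega (a * b ≐ b * a)
| ax_mul1 : forall G (a : tm G N), RCA0omega (a * 1 ≐ a)
| ax_mul0 : forall G (a : tm G N), RCA0omega (a * 0 ≐ 0)
| ax_mulD : forall G (a b c : tm G N), RCA0omega (a * (b + c) ≐ a * b + a * c)
| ax_lt_irrefl : forall G (a : tm G N), RCA0omega (a ≺ a ⊃ Bot)
| ax_lt_trans : forall G (a b c : tm G N), RCA0omega (a ≺ b ⊃ b ≺ c ⊃ a ≺ c)
| ax_lt_total : forall G (a b : tm G N), RCA0omega (a ≺ b ⊔ a ≐ b ⊔ b ≺ a)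
| ax_lt_01 : forall G, RCA0omega ((0 : tm G N) ≺ 1)
| ax_lt_add : forall G (a b c : tm G N), RCA0omega (a ≺ b ⊃ a + c ≺ b + c)
| ax_lt_mul : forall G (a b c : tm G N),
    RCA0omega (0 ≺ c ⊃ a ≺ b ⊃ a * c ≺ b * c)
| ax_Pi : forall G s t (x : tm G s) (y : tm G t),
    RCA0omega (eqty (Pi s t · x · y) x)
| ax_Sigma : forall G r s t (x : tm G (r ⇒ s ⇒ t)) (y : tm G (r ⇒ s)) (z : tm G r),
    RCA0omega (eqty (Sigma r s t · x · y · z) (x · z · (y · z)))
| ax_Rec0 : forall G (f : tm G (N ⇒ N ⇒ N)) (m : tm G N),
    RCA0omega (Rec · f · m · 0 ≐ m)
| ax_RecS : forall G (f : tm G (N ⇒ N ⇒ N)) (m n : tm G N),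
    RCA0omega (Rec · f · m · (n + 1) ≐ f · n · (Rec · f · m · n))
| ax_ext : forall G s t (x y : tm G s) (f : tm G (s ⇒ t)),
    RCA0omega (eqty x y ⊃ eqty (f · x) (f · y))
| ax_ind : forall G (A : fm (N :: G)), qf A ->
    RCA0omega (inst A 0
               ⊃ All N (A ⊃ sub_fm A (scons (v0 + 1) (@shift G N)))
               ⊃ All N A)
(* QF-AC^{1,0}; in [A] the variable [v1] is [x^1] and [v0] is [y^0] *)
| ax_qfac : forall G (A : fm (N :: ty1 :: G)), qf A ->
    RCA0omega (All ty1 (Ex N A)
               ⊃ Ex ty2 (All ty1
                   (sub_fm A (scons (v1 · v0)
                               (scons v0 (fun t x => Var (vs (vs x)))))))).

Definition pair0 G (a b : tm G N) : tm G N := (a + b) * (a + b) + a.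

(** The coded pair of [n^0] and [f^1] is the sequence [n, f(0), f(1), ...]: since
    [Sigma (Pi Pi) f i x = f i], this term maps [0] to [n] and [k+1] to [f(k)]. *)
Definition pair10 G (f : tm G ty1) (n : tm G N) : tm G ty1 :=
  Rec · (Sigma N N ty1 · (Pi (N ⇒ N ⇒ N) N · Pi N N) · f) · n.

(** A finite sequence of numbers is coded by a number using Gödel's beta
    function: [c = <l, <a, b>>] codes the sequence of length [l] whose [k]-th
    term is the remainder of [a] modulo [1 + (k+1) b].  [mem0 m c] says that [m]
    is one of the terms of the sequence coded by [c]; the bound variables are,
    from the outside, [l], [a], [b], [k] and the quotient. *)
Definition mem0 G (m c : tm G N) : fm G :=
  Ex N (Ex N (Ex N (
    wk (wk (wk c)) ≐ pair0 v2 (pair0 v1 v0) ⊓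
    Ex N (v0 ≺ v3 ⊓
      Ex N (v3 ≐ v0 * (1 + (v1 + 1) * v2) + wk (wk (wk (wk (wk m)))) ⊓
            wk (wk (wk (wk (wk m)))) ≺ 1 + (v1 + 1) * v2))))).

(** A finite sequence [f_0, ..., f_(k-1)] of type 1 objects is coded by the type 1
    object [s] with [s(0) = k] and [s(1 + m k + i) = f_i(m)] for [i < k]; when
    [k = 0], [s] is constantly [0].  So every finite sequence has exactly one
    code, and [seq1 s] says that [s] is a code. *)
Definition seq1 G (s : tm G ty1) : fm G :=
  s · 0 ≐ 0 ⊃ All N (wk s · v0 ≐ 0).

Definition mem1 G (j s : tm G ty1) : fm G :=
  Ex N (v0 ≺ wk s · 0 ⊓
    All N (wk (wk j) · v0 ≐
           wk (wk s) · (1 + (v0 * (wk (wk s) · 0) + v1)))).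

Definition subset1 G (J K : tm G ty1) : fm G :=
  All ty1 (mem1 v0 (wk J) ⊃ mem1 v0 (wk K)).

(** Since every sequence has exactly one code, these are the quantifiers over
    finite sequences of type [1^*]. *)
Definition All1s G (A : fm (ty1 :: G)) : fm G := All ty1 (seq1 v0 ⊃ A).
Definition Ex1s G (A : fm (ty1 :: G)) : fm G := Ex ty1 (seq1 v0 ⊓ A).

(** A set [X] is given by its characteristic function, with value [1] on the
    elements of [X]. *)
Definition BOOT : fm [] :=
  All ty2 (* Y *) (
  Ex ty1 (* X *) (
    All N (* n *) (v1 · v0 ≐ 0 ⊔ v1 · v0 ≐ 1) ⊓
    All N (* n *) (
      Iff (v1 · v0 ≐ 1)
          (Ex ty1 (* f *) (v3 · pair10 v0 v1 ≐ 0))))).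

(** [A i] is the code of the finite set [A_i], and [F_ J] is the functional [F_J]. *)
Definition Rado : fm [] :=
  All (ty1 ⇒ N) (* A *) (
  All (ty1 ⇒ ty2) (* F_ *) (
    All ty1 (* i *) (Ex N (* m *) (mem0 v0 (v3 · v1))) ⊃
    All1s (* J *) (All ty1 (* j *) (
      mem1 v0 v1 ⊃ mem0 (v2 · v1 · v0) (v3 · v0))) ⊃
    Ex ty2 (* F *) (
      All ty1 (* i *) (mem0 (v1 · v0) (v3 · v0)) ⊓
      All1s (* J *) (Ex1s (* K *) (
        subset1 v1 v0 ⊓
        All ty1 (* j *) (
          mem1 v0 v2 ⊃ v3 · v0 ≐ v4 · v1 · v0)))))).

(* Main.v *)
Require Import Defs.
From Stdlib Require Import List Setoid Morphisms.
Import ListNotations.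

Set Implicit Arguments.
Unset Strict Implicit.
Unset Printing Implicit Defensive.

(** Call [i] an index for the number [n = i(0)].  Take all the sets [A_i] to be
    [{0, 1}], and for a nonempty sequence [J] let [F_J(i)] be [1] if some entry [f]
    of [J] satisfies [Y(f, i(0)) = 0], and [0] otherwise.  Suppose that [F] is a
    choice function which agrees on each finite [J] with [F_K] for some [K]
    containing [J].  Then [X(n) = F(c_n)], with [c_n] the constant function [n],
    is the characteristic function that is wanted.

    - If [Y(f, n) = 0], compare [F] with [F_K] for some [K] containing the two
      elements [c_n] and [f].  Since [f] is in [K] and [c_n] is an index for [n],
      [F(c_n) = F_K(c_n) = 1] ([on_constants_1]).
    - If [F(c_n) = 1], some [F_K(c_n)] is [1], so an entry of [K] is an [f] with
      [Y(f, n) = 0]; otherwise [F(c_n) = 0] ([on_constants_cases]).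

    Everything that has to exist here is given by a term; what takes work
    is carrying this out with quantifier-free induction.  The value of [F_J] must
    be computed by a term: [search] finds by primitive recursion the number of an
    entry of [J] that is a witness, if there is one ([search_spec]).
    The induction for [search_spec] needs that [k < l + 1] implies [k < l] or
    [k = l]; this is obtained from truncated subtraction, because the quantifier
    over [d] in [k + d = l] is not available in an induction formula.  The two-element sequence [pairseq] is built with terms for parity
    and halving, and extensionality transfers [Y(f, n) = 0] from [f] to the entry
    of [K] equal to it.

    Closed terms are obtained by bracket abstraction [lam], whose beta rule is
    [beta_sub].  Provable equality [teq] at each type is a congruence for
    application, and equational steps of the derivation are rewriting steps with
    [teq]. *)

Notation "H ⊢ A" := (Prf RCA0omega H A) (at level 95, no associativity).

(** * Substitution *)

Lemma sub_tm_ext G t (a : tm G t) D (e e' : sub G D) :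
  (forall s (x : var G s), e s x = e' s x) -> sub_tm e a = sub_tm e' a.
Proof. intros E; induction a; cbn; try congruence; apply E. Qed.

Lemma sub_tm_comp G t (a : tm G t) D F (e : sub G D) (r : sub D F) :
  sub_tm r (sub_tm e a) = sub_tm (fun s x => sub_tm r (e s x)) a.
Proof. induction a; cbn; try reflexivity; congruence. Qed.

Lemma sub_tm_id G t (a : tm G t) : sub_tm (@sid G) a = a.
Proof. induction a; cbn; try reflexivity; congruence. Qed.

Lemma sub_wk G D s t (a : tm G t) (b : tm D s) (e : sub G D) :
  sub_tm (scons b e) (wk a) = sub_tm e a.
Proof. unfold wk; rewrite sub_tm_comp; now apply sub_tm_ext. Qed.

Lemma sub_up_wk G D s t (a : tm G t) (e : sub G D) :
  sub_tm (up e) (@wk G s t a) = wk (sub_tm e a).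
Proof.
  unfold up; rewrite sub_wk; unfold wk; now rewrite sub_tm_comp.
Qed.

Lemma up_vz G D s (e : sub G D) : @up G D s e s vz = v0.
Proof. reflexivity. Qed.

Lemma up_vs G D s t (e : sub G D) (x : var G t) : @up G D s e t (vs x) = wk (e t x).
Proof. reflexivity. Qed.

Lemma sub_shift G s t (a : tm G t) : sub_tm (@shift G s) a = wk a.
Proof. reflexivity. Qed.

Lemma sub_eqty t : forall G D (x y : tm G t) (e : sub G D),
  sub_fm (eqty x y) e = eqty (sub_tm e x) (sub_tm e y).
Proof.
  induction t as [|s _ t IH]; intros; cbn; [reflexivity|].
  rewrite IH; cbn; now rewrite !sub_up_wk.
Qed.

Lemma wk_eqty G s t (x y : tm G t) : @wk_fm G s (eqty x y) = eqty (wk x) (wk y).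
Proof. apply sub_eqty. Qed.

Lemma wk_App G r s t (f : tm G (s ⇒ t)) a : @wk G r t (f · a) = wk f · wk a.
Proof. reflexivity. Qed.

(** Computes a substitution instance down to the parameters, where it rewrites
    with the laws above. *)
Ltac norm :=
  unfold inst, wk_fm, Iff, pair0; cbn [sub_fm sub_tm scons qf shift map];
  repeat first
    [ rewrite sub_wk | rewrite sub_tm_id | rewrite sub_up_wk
    | rewrite up_vz | rewrite up_vs
    | rewrite sub_shift | rewrite sub_eqty | rewrite wk_App
    | progress cbn [sub_fm sub_tm scons qf shift map] ].

(** * Derived rules *)

Lemma weaken_incl G (H : list (fm G)) A :
  H ⊢ A -> forall H', incl H H' -> H' ⊢ A.
Proof.
  induction 1; intros H' I.
  - now apply PAx.
  - apply PHyp; auto.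
  - apply PImpI, IHPrf. intros x [->|h]; [now left|right; auto].
  - eapply PImpE; eauto.
  - apply PAndI; auto.
  - eapply PAndE1; eauto.
  - eapply PAndE2; eauto.
  - apply POrI1; auto.
  - apply POrI2; auto.
  - eapply POrE; [eauto| |].
    + apply IHPrf2. intros x [->|h]; [now left|right; auto].
    + apply IHPrf3. intros x [->|h]; [now left|right; auto].
  - apply PRaa, IHPrf. intros x [->|h]; [now left|right; auto].
  - apply PAllI, IHPrf. now apply incl_map.
  - now apply PAllE, IHPrf.
  - eapply PExI, IHPrf; auto.
  - eapply PExE; [eauto|].
    apply IHPrf2. intros x [->|h]; [now left|right]. eapply incl_map; eauto.
Qed.

Lemma weaken G (H : list (fm G)) A B : H ⊢ A -> B :: H ⊢ A.
Proof. intros h; eapply weaken_incl; [exact h|]. intros x; now right. Qed.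

Lemma cut G (H : list (fm G)) A B : H ⊢ A -> A :: H ⊢ B -> H ⊢ B.
Proof. intros a b; exact (PImpE (PImpI b) a). Qed.

Lemma bot_elim G (H : list (fm G)) A : H ⊢ Bot -> H ⊢ A.
Proof. intros h; apply PRaa, weaken, h. Qed.

Ltac reassume := unfold incl; cbn [In]; tauto.

(** In this rule and in [ex_intro] and [qf_ind] the substitution instance is only
    required to be equal to a given formula, as substitution into an abstract
    weakened term does not compute. *)
Lemma all_elim G (H : list (fm G)) s (A : fm (s :: G)) (a : tm G s) B :
  H ⊢ All s A -> inst A a = B -> H ⊢ B.
Proof. intros h <-; now apply PAllE. Qed.

Lemma ex_intro G (H : list (fm G)) s (A : fm (s :: G)) (a : tm G s) B :
  H ⊢ B -> inst A a = B -> H ⊢ Ex s A.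
Proof. intros h <-; eapply PExI, h. Qed.

Lemma qf_ind G (H : list (fm G)) (A : fm (N :: G)) (a : tm G N) B :
  qf A -> inst A a = B -> H ⊢ inst A 0 ->
  A :: map wk_fm H ⊢ sub_fm A (scons (v0 + 1) (@shift G N)) -> H ⊢ B.
Proof.
  intros q <- z s. apply PAllE.
  eapply PImpE; [eapply PImpE; [apply PAx, ax_ind, q|exact z]|].
  apply PAllI, PImpI, s.
Qed.

(** * Provable equality *)

Definition teq G (H : list (fm G)) t (x y : tm G t) : Prop := H ⊢ eqty x y.

(* The abbreviations introduced by [name_hyps] below are expanded first. *)
Ltac hyp :=
  repeat match goal with K := _ :: _ |- _ => subst K end;
  unfold teq; cbn [eqty];
  solve [ eassumption | apply PHyp; cbn [In]; tauto | apply weaken; hyp ].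

Lemma teq_app_l G (H : list (fm G)) s t (f g : tm G (s ⇒ t)) a :
  teq H f g -> teq H (f · a) (g · a).
Proof.
  intros h; unfold teq in *; cbn in h.
  eapply all_elim with (a := a); [exact h|]. now norm.
Qed.

(** This half of congruence is the axiom of extensionality; the other half, for a
    varying function, is an instance of the definition of equality. *)
Lemma teq_app_r G (H : list (fm G)) s t (f : tm G (s ⇒ t)) a b :
  teq H a b -> teq H (f · a) (f · b).
Proof. intros h; exact (PImpE (PAx H (ax_ext a b f)) h). Qed.

Lemma teq_refl G (H : list (fm G)) t (x : tm G t) : teq H x x.
Proof.
  revert G H x; induction t as [|s _ t IH]; intros; unfold teq; cbn.
  - apply PAx, ax_refl.
  - apply PAllI, IH.
Qed.

(** Symmetry and transitivity are proved as implications, since the induction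
    goes under a quantifier: there an assumption can be moved to the larger
    context, whereas a derivation cannot without a renaming lemma. *)
Lemma teq_sym_imp t : forall G (H : list (fm G)) (x y : tm G t),
  H ⊢ (eqty x y ⊃ eqty y x).
Proof.
  induction t as [|s _ t IH]; intros.
  - apply PAx, ax_sym.
  - apply PImpI. cbn [eqty]. apply PAllI.
    eapply PImpE; [apply IH|]. apply teq_app_l.
    apply PHyp; left. now rewrite <- wk_eqty.
Qed.

Lemma teq_trans_imp t : forall G (H : list (fm G)) (x y z : tm G t),
  H ⊢ (eqty x y ⊃ eqty y z ⊃ eqty x z).
Proof.
  induction t as [|s _ t IH]; intros.
  - apply PAx, ax_trans.
  - apply PImpI, PImpI. cbn [eqty]. apply PAllI.
    eapply PImpE; [eapply PImpE; [apply IH with (y := wk y · v0)|]|];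
      apply teq_app_l; apply PHyp; [right; left|left]; now rewrite <- wk_eqty.
Qed.

(** Rewriting by a provable equation would otherwise also look for its left-hand
    side inside the list of assumptions. *)
Ltac name_hyps K :=
  match goal with
  | |- Prf _ ?L _ => set (K := L) in *
  | |- teq ?L _ _ => set (K := L) in *
  end.

#[export] Instance teq_equiv G (H : list (fm G)) t : Equivalence (@teq G H t).
Proof.
  split.
  - intros x; apply teq_refl.
  - intros x y h; exact (PImpE (teq_sym_imp _ _ _) h).
  - intros x y z h k; exact (PImpE (PImpE (teq_trans_imp _ _ _ _) h) k).
Qed.

#[export] Instance App_proper G (H : list (fm G)) s t :
  Proper (@teq G H (s ⇒ t) ==> @teq G H s ==> @teq G H t) (@App G s t).
Proof.
  intros f g h a b k. transitivity (g · a).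
  - now apply teq_app_l.
  - now apply teq_app_r.
Qed.

(** With this relation on formulas, terms can be rewritten inside the two kinds of
    prime formulas. *)
Definition fequiv G (H : list (fm G)) (A B : fm G) : Prop := (H ⊢ A) <-> (H ⊢ B).

#[export] Instance Prf_proper G (H : list (fm G)) :
  Proper (fequiv H ==> iff) (@Prf RCA0omega G H).
Proof. intros A B h; exact h. Qed.

#[export] Instance Eq_proper G (H : list (fm G)) :
  Proper (@teq G H N ==> @teq G H N ==> fequiv H) (@Eq G).
Proof.
  intros a a' h b b' k; change (teq H a b <-> teq H a' b').
  rewrite h, k; reflexivity.
Qed.

#[export] Instance Lt_proper G (H : list (fm G)) :
  Proper (@teq G H N ==> @teq G H N ==> fequiv H) (@Lt G).
Proof.
  assert (L : forall a a' b b' : tm G N,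
             teq H a a' -> teq H b b' -> H ⊢ a ≺ b -> H ⊢ a' ≺ b').
  { intros a a' b b' h k l.
    exact (PImpE (PImpE (PImpE (PAx H (ax_lt_eq a a' b b')) h) k) l). }
  intros a a' h b b' k; split; apply L; auto; now symmetry.
Qed.

Lemma teq_Pi G (H : list (fm G)) s t (x : tm G s) (y : tm G t) :
  teq H (Pi s t · x · y) x.
Proof. apply PAx, ax_Pi. Qed.

Lemma teq_Sigma G (H : list (fm G)) r s t (x : tm G (r ⇒ s ⇒ t)) y z :
  teq H (Sigma r s t · x · y · z) (x · z · (y · z)).
Proof. apply PAx, ax_Sigma. Qed.

Lemma teq_Rec0 G (H : list (fm G)) f m : teq H (Rec · f · m · 0) m.
Proof. apply (PAx H), ax_Rec0. Qed.

Lemma teq_RecS G (H : list (fm G)) f m n :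
  teq H (Rec · f · m · (n + 1)) (f · n · (Rec · f · m · n)).
Proof. apply (PAx H), ax_RecS. Qed.

(** * Bracket abstraction *)

(** Strengthening, the partial inverse of weakening.  Abstracting a term that does
    not contain the variable as a constant function keeps the nested
    abstractions below small. *)
Definition str_var G s t (x : var (s :: G) t) : option (tm G t) :=
  match x in var (_ :: G') t' return option (tm G' t') with
  | vz => None
  | vs y => Some (Var y)
  end.

Fixpoint str G s t (a : tm (s :: G) t) : option (tm G t) :=
  match a with
  | Var x => str_var x
  | App f b =>
      match str f, str b with
      | Some f', Some b' => Some (f' · b')
      | _, _ => None
      end
  | Zero => Some Zero
  | One => Some One
  | Plus => Some Plus
  | Times => Some Times
  | Pi s t => Some (Pi s t)
  | Sigma r s t => Some (Sigma r s t)
  | Rec => Some Rec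
  end.

Lemma var_case G s (P : forall t, var (s :: G) t -> Prop) :
  P s vz -> (forall t (y : var G t), P t (vs y)) -> forall t x, P t x.
Proof.
  intros z h t x. revert P z h.
  refine (match x in var G' t' return
            match G' return var G' t' -> Prop with
            | [] => fun _ => True
            | s' :: G1 => fun x => forall P : forall t, var (s' :: G1) t -> Prop,
                P s' vz -> (forall t y, P t (vs y)) -> P t' x
            end x
          with vz => _ | vs y => _ end); cbn; auto.
Qed.

Lemma str_sound G s t (a : tm (s :: G) t) b : str a = Some b -> a = wk b.
Proof.
  revert b; induction a as [t x|r t f IHf a IHa| | | | | | |]; intros b; cbn;
    try (intros [= <-]; reflexivity).
  - revert t x b; apply (var_case (P := fun t x => forall b, str_var x = Some b -> Var x = wk b)).
    + discriminate.
    + intros t y b [= <-]; reflexivity.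
  - destruct (str f) as [f'|], (str a) as [a'|]; try discriminate.
    intros [= <-]. now rewrite wk_App, <- IHf, <- IHa.
Qed.

Definition lam_var G s t (x : var (s :: G) t) : tm G (s ⇒ t) :=
  match x in var (s' :: G') t' return tm G' (s' ⇒ t') with
  | @vz G' s' => Sigma s' (N ⇒ s') s' · Pi s' (N ⇒ s') · Pi s' N
  | @vs G' s' t' y => Pi t' s' · Var y
  end.

Fixpoint lam G s t (a : tm (s :: G) t) : tm G (s ⇒ t) :=
  match str a with
  | Some b => Pi t s · b
  | None =>
      match a in tm _ t' return tm G (s ⇒ t') with
      | Var x => lam_var x
      | App f b => Sigma _ _ _ · lam f · lam b
      | Zero => Pi _ s · Zero
      | One => Pi _ s · One
      | Plus => Pi _ s · Plus
      | Times => Pi _ s · Times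
      | Pi r t => Pi _ s · Pi r t
      | Sigma q r t => Pi _ s · Sigma q r t
      | Rec => Pi _ s · Rec
      end
  end.

(** Substitution does not commute with [lam]: a variable replaced by an application
    is abstracted differently.  The beta rule is therefore stated below a
    substitution, which is the form needed for the inner ones of several nested
    abstractions. *)
Lemma beta_sub G D (H : list (fm D)) s t (a : tm (s :: G) t) (c : tm D s) (e : sub G D) :
  teq H (sub_tm e (lam a) · c) (sub_tm (scons c e) a).
Proof.
  assert (K : forall t' (a : tm (s :: G) t') b, str a = Some b ->
    teq H (sub_tm e (Pi t' s · b) · c) (sub_tm (scons c e) a)).
  { intros t' a' b E. rewrite (str_sound E), sub_wk. apply teq_Pi. }
  induction a as [t x|r t f IHf a IHa| | | | | | |]; try apply teq_Pi.
  - revert t x K.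
    apply (var_case (P := fun t x => _ -> teq H (sub_tm e (lam (Var x)) · c) (sub_tm (scons c e) (Var x)))); cbn.
    + intros _. rewrite teq_Sigma, teq_Pi. reflexivity.
    + intros t y _. apply teq_Pi.
  - specialize (K t (f · a)). cbn [lam]. destruct (str (f · a)) as [b|].
    + now apply K.
    + cbn [sub_tm]. rewrite teq_Sigma. now rewrite IHf, IHa.
Qed.

Lemma beta G (H : list (fm G)) s t (a : tm (s :: G) t) (c : tm G s) :
  teq H (lam a · c) (sub_tm (scons c (@sid G)) a).
Proof.
  rewrite <- beta_sub. now rewrite sub_tm_id.
Qed.

(** * Arithmetic *)

Section Arith.
Context (G : ctx) (H : list (fm G)).
Implicit Types a b c : tm G N.

Lemma teq_addC a b : teq H (a + b) (b + a).
Proof. apply (PAx H), ax_addC. Qed.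

Lemma teq_addA a b c : teq H (a + (b + c)) (a + b + c).
Proof. apply (PAx H), ax_addA. Qed.

Lemma teq_add0 a : teq H (a + 0) a.
Proof. apply (PAx H), ax_add0. Qed.

Lemma teq_add0l a : teq H (0 + a) a.
Proof. now rewrite teq_addC, teq_add0. Qed.

Lemma teq_mulC a b : teq H (a * b) (b * a).
Proof. apply (PAx H), ax_mulC. Qed.

Lemma teq_mul1 a : teq H (a * 1) a.
Proof. apply (PAx H), ax_mul1. Qed.

Lemma teq_mulD a b c : teq H (a * (b + c)) (a * b + a * c).
Proof. apply (PAx H), ax_mulD. Qed.

Lemma lt_irrefl a : H ⊢ a ≺ a -> H ⊢ Bot.
Proof. exact (PImpE (PAx H (ax_lt_irrefl a))). Qed.

Lemma lt_trans a b c : H ⊢ a ≺ b -> H ⊢ b ≺ c -> H ⊢ a ≺ c.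
Proof. intros h k; exact (PImpE (PImpE (PAx H (ax_lt_trans a b c)) h) k). Qed.

Lemma lt_add a b c : H ⊢ a ≺ b -> H ⊢ a + c ≺ b + c.
Proof. exact (PImpE (PAx H (ax_lt_add a b c))). Qed.

Lemma lt_succ a : H ⊢ a ≺ a + 1.
Proof.
  assert (h : H ⊢ 0 + a ≺ 1 + a) by apply lt_add, PAx, ax_lt_01.
  now rewrite teq_add0l, teq_addC in h.
Qed.

Lemma lt_cases a b C :
  (a ≺ b) :: H ⊢ C -> (a ≐ b) :: H ⊢ C -> (b ≺ a) :: H ⊢ C -> H ⊢ C.
Proof.
  intros h k l. eapply POrE; [apply PAx, (ax_lt_total a b)|exact h|].
  eapply POrE; [apply PHyp; now left| |].
  - apply (weaken_incl k). reassume.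
  - apply (weaken_incl l). reassume.
Qed.

End Arith.

(** Below [0] there is an infinite descent: [n + 1 < 0] gives [n < 0]. *)
Lemma not_lt_0 G (H : list (fm G)) a C : H ⊢ a ≺ 0 -> H ⊢ C.
Proof.
  intros h; apply bot_elim. eapply PImpE; [|exact h].
  apply qf_ind with (A := (v0 ≺ 0 ⊃ Bot)) (a := a); norm; auto.
  - apply PAx, ax_lt_irrefl.
  - apply PImpI. eapply PImpE; [hyp|].
    apply lt_trans with (v0 + 1); [apply lt_succ|hyp].
Qed.

Lemma succ_neq_0 G (H : list (fm G)) a C : teq H (a + 1) 0 -> H ⊢ C.
Proof.
  intros h. apply not_lt_0 with a. rewrite <- h. apply lt_succ.
Qed.

(** ** Predecessor and truncated subtraction *)

Definition pred {G} : tm G ty1 := Rec · Pi N N · 0.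

Lemma pred_S G (H : list (fm G)) a : teq H (pred · (a + 1)) a.
Proof. unfold pred. now rewrite teq_RecS, teq_Pi. Qed.

Lemma nat_cases G (H : list (fm G)) a C :
  (a ≐ 0) :: H ⊢ C -> (a ≐ pred · a + 1) :: H ⊢ C -> H ⊢ C.
Proof.
  apply POrE.
  apply qf_ind with (A := (v0 ≐ 0 ⊔ v0 ≐ pred · v0 + 1)) (a := a); norm; auto.
  - apply POrI1, PAx, ax_refl.
  - apply POrI2. rewrite (pred_S _ v0). apply PAx, ax_refl.
Qed.

Lemma lt_add_cancel G (H : list (fm G)) a b c : H ⊢ a + c ≺ b + c -> H ⊢ a ≺ b.
Proof.
  intros h. apply lt_cases with a b; [hyp| |]; apply bot_elim, lt_irrefl with (a + c).
  - apply weaken with (B := a ≐ b) in h; name_hyps K.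
    assert (e : teq K a b) by hyp. now rewrite <- e in h.
  - apply lt_trans with (b + c); [hyp|]. apply lt_add; hyp.
Qed.

Definition minus {G} : tm G (N ⇒ N ⇒ N) := Rec · (Pi ty1 N · pred).

Lemma minus_0 G (H : list (fm G)) a : teq H (minus · a · 0) a.
Proof. apply teq_Rec0. Qed.

Lemma minus_S G (H : list (fm G)) a b :
  teq H (minus · a · (b + 1)) (pred · (minus · a · b)).
Proof. unfold minus. now rewrite teq_RecS, teq_Pi. Qed.

(** The difference of [b] and [a] as a term: this makes [a <= b] the
    quantifier-free formula [a + (b - a) = b]. *)
Lemma le_cases G (H : list (fm G)) a b C :
  (b ≺ a) :: H ⊢ C -> (a + minus · b · a ≐ b) :: H ⊢ C -> H ⊢ C.
Proof.
  apply POrE.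
  apply qf_ind with (A := (wk b ≺ v0 ⊔ v0 + minus · wk b · v0 ≐ wk b)) (a := a);
    norm; auto.
  - apply POrI2. rewrite teq_add0l, minus_0. apply PAx, ax_refl.
  - eapply POrE; [apply PHyp; now left| |].
    + apply POrI1, lt_trans with v0; [hyp|apply lt_succ].
    + apply nat_cases with (minus · wk b · v0).
      * apply POrI1. name_hyps K.
        assert (e : teq K (v0 + minus · wk b · v0) (wk b)) by hyp.
        assert (z : teq K (minus · wk b · v0) 0) by hyp.
        assert (f : teq K v0 (wk b)) by (rewrite z, teq_add0 in e; exact e).
        rewrite <- f. apply lt_succ.
      * apply POrI2. name_hyps K.
        assert (e : teq K (v0 + minus · wk b · v0) (wk b)) by hyp.
        assert (z : teq K (minus · wk b · v0) (pred · (minus · wk b · v0) + 1)) by hyp.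
        change (teq K (v0 + 1 + minus · wk b · (v0 + 1)) (wk b)).
        transitivity (v0 + (pred · (minus · wk b · v0) + 1)).
        -- now rewrite minus_S, (teq_addC _ (pred · _) 1), teq_addA.
        -- now rewrite <- z.
Qed.

(** Discreteness of the order: if [b < a < b + 1], then [a = b + d] with [d] below
    [1], and [d] is neither [0] nor a successor. *)
Lemma lt_succ_cases G (H : list (fm G)) a b C : H ⊢ a ≺ b + 1 ->
  (a ≺ b) :: H ⊢ C -> (a ≐ b) :: H ⊢ C -> H ⊢ C.
Proof.
  intros h k l. apply lt_cases with a b; auto.
  apply le_cases with b a.
  - apply bot_elim, lt_irrefl with a. apply lt_trans with b; hyp.
  - apply nat_cases with (minus · a · b); name_hyps K;
      assert (e : teq K (b + minus · a · b) a) by hyp.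
    + assert (z : teq K (minus · a · b) 0) by hyp.
      rewrite z, teq_add0 in e.
      apply bot_elim, lt_irrefl with a. rewrite <- e at 1. hyp.
    + assert (z : teq K (minus · a · b) (pred · (minus · a · b) + 1)) by hyp.
      rewrite z in e.
      apply not_lt_0 with (pred · (minus · a · b)).
      apply lt_add_cancel with 1, lt_add_cancel with b.
      rewrite (teq_addC _ _ b), e, teq_add0l, (teq_addC _ 1 b). hyp.
Qed.

(** ** Definition by cases and bounded search *)

(** [cnd a x y] is [x] if [a] is [0], and [y] otherwise. *)
Definition cnd {G} : tm G (N ⇒ N ⇒ N ⇒ N) :=
  lam (lam (lam (Rec · (Pi ty1 N · (Pi N N · v0)) · v1 · v2))).

Lemma cnd_Rec G (H : list (fm G)) a x y :
  teq H (cnd · a · x · y) (Rec · (Pi ty1 N · (Pi N N · y)) · x · a).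
Proof. unfold cnd. now rewrite beta, !beta_sub. Qed.

Lemma cnd_0 G (H : list (fm G)) a x y : teq H a 0 -> teq H (cnd · a · x · y) x.
Proof. intros ->. now rewrite cnd_Rec, teq_Rec0. Qed.

Lemma cnd_S G (H : list (fm G)) a b x y :
  teq H a (b + 1) -> teq H (cnd · a · x · y) y.
Proof. intros ->. now rewrite cnd_Rec, teq_RecS, !teq_Pi. Qed.

(** [search p l] is the largest zero of [p] below [l], or [0] if there is none. *)
Definition search {G} : tm G (ty1 ⇒ N ⇒ N) :=
  lam (Rec · (lam (lam (cnd · (v2 · v1) · v1 · v0))) · 0).

Lemma search_S G (H : list (fm G)) p l :
  teq H (search · p · (l + 1)) (cnd · (p · l) · l · (search · p · l)).
Proof.
  unfold search. rewrite beta. cbn [sub_tm]. rewrite teq_RecS.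
  rewrite !beta_sub. reflexivity.
Qed.

(** The conclusion is that [p] vanishes at the value found, a quantifier-free form
    of the existence of a zero; this makes an induction on [l] possible. *)
Lemma search_spec G (H : list (fm G)) p k l :
  H ⊢ k ≺ l -> teq H (p · k) 0 -> teq H (p · (search · p · l)) 0.
Proof.
  intros h z. eapply PImpE; [|exact h]. eapply PImpE; [|exact z].
  apply qf_ind with (a := l)
    (A := (wk p · wk k ≐ 0 ⊃ wk k ≺ v0 ⊃ wk p · (search · wk p · v0) ≐ 0)); norm; auto.
  - apply PImpI, PImpI, not_lt_0 with k. hyp.
  - apply PImpI, PImpI.
    apply nat_cases with (wk p · v0); name_hyps K.
    + assert (e : teq K (wk p · v0) 0) by hyp.
      rewrite search_S, cnd_0; [hyp|exact e].
    + assert (e : teq K (wk p · v0) (pred · (wk p · v0) + 1)) by hyp.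
      rewrite search_S, cnd_S; [|exact e].
      apply lt_succ_cases with (wk k) v0; [hyp| |].
      * eapply PImpE; [eapply PImpE; hyp|hyp].
      * name_hyps K'.
        assert (i : teq K' (wk k) v0) by hyp.
        assert (j : teq K' (wk p · wk k) 0) by hyp.
        apply succ_neq_0 with (pred · (wk p · v0)).
        transitivity (wk p · v0); [symmetry; hyp|].
        now rewrite <- i.
Qed.

(** * Finite sequences *)

Definition parity {G} : tm G ty1 := Rec · (Pi ty1 N · lam (cnd · v0 · 1 · 0)) · 0.

Lemma parity_S G (H : list (fm G)) a :
  teq H (parity · (a + 1)) (cnd · (parity · a) · 1 · 0).
Proof. unfold parity. rewrite teq_RecS, teq_Pi, beta. reflexivity. Qed.

Definition half {G} : tm G ty1 := Rec · lam (lam (v0 + parity · v1)) · 0.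

Lemma half_S G (H : list (fm G)) a :
  teq H (half · (a + 1)) (half · a + parity · a).
Proof. unfold half. rewrite teq_RecS, beta, beta_sub. reflexivity. Qed.

Lemma teq_mul2 G (H : list (fm G)) a : teq H (a * (1 + 1)) (a + a).
Proof. now rewrite teq_mulD, teq_mul1. Qed.

Lemma double_S G (H : list (fm G)) a :
  teq H ((a + 1) * (1 + 1)) (a * (1 + 1) + 1 + 1).
Proof.
  rewrite !teq_mul2, teq_addA, <- (teq_addA H a 1 a), (teq_addC H 1 a).
  now rewrite teq_addA.
Qed.

Lemma parity_succ_even G (H : list (fm G)) a :
  teq H (parity · a) 0 -> teq H (parity · (a + 1)) 1.
Proof. intros h. now rewrite parity_S, cnd_0. Qed.

Lemma even_spec G (H : list (fm G)) a :
  H ⊢ (parity · (a * (1 + 1)) ≐ 0 ⊓ half · (a * (1 + 1)) ≐ a).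
Proof.
  apply qf_ind with (a := a)
    (A := (parity · (v0 * (1 + 1)) ≐ 0 ⊓ half · (v0 * (1 + 1)) ≐ v0)); norm; auto.
  - assert (z : teq H (0 * (1 + 1)) 0) by now rewrite teq_mul2, teq_add0.
    apply PAndI; rewrite z; apply teq_Rec0.
  - name_hyps K.
    assert (p : teq K (parity · (v0 * (1 + 1))) 0)
      by (eapply PAndE1; apply PHyp; now left).
    assert (h : teq K (half · (v0 * (1 + 1))) v0)
      by (eapply PAndE2; apply PHyp; now left).
    pose proof (parity_succ_even p) as q.
    apply PAndI; rewrite double_S.
    + rewrite parity_S. apply cnd_S with 0. now rewrite q, teq_add0l.
    + rewrite !half_S, p, h, q, teq_add0. apply (teq_refl K (v0 + 1)).
Qed.

Lemma parity_even G (H : list (fm G)) a : teq H (parity · (a * (1 + 1))) 0.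
Proof. exact (PAndE1 (even_spec H a)). Qed.

Lemma half_even G (H : list (fm G)) a : teq H (half · (a * (1 + 1))) a.
Proof. exact (PAndE2 (even_spec H a)). Qed.

(** In the code of a sequence of length [2], the value at [m] of the entry [i] is at
    the argument [x + 1] with [x = 2m + i]; so [i] is the parity of [x], and [m] its
    half. *)
Definition pairseq {G} : tm G (ty1 ⇒ ty1 ⇒ ty1) :=
  lam (lam (Rec · lam (lam
    (cnd · (parity · v1) · (v3 · (half · v1)) · (v2 · (half · v1)))) · (1 + 1))).

Lemma pairseq_0 G (H : list (fm G)) f g : teq H (pairseq · f · g · 0) (1 + 1).
Proof. unfold pairseq. rewrite beta, beta_sub. apply teq_Rec0. Qed.

Lemma pairseq_S G (H : list (fm G)) f g a :
  teq H (pairseq · f · g · (a + 1))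
    (cnd · (parity · a) · (f · (half · a)) · (g · (half · a))).
Proof.
  unfold pairseq. rewrite beta, beta_sub. cbn [sub_tm].
  rewrite teq_RecS, !beta_sub. reflexivity.
Qed.

(** The argument at which the coding of sequences of type 1 objects puts the value
    at [m] of the entry [k]; for [k] beyond the length the row has no meaning. *)
Definition row {G} : tm G (ty1 ⇒ N ⇒ ty1) :=
  lam (lam (lam (v2 · (1 + (v0 * (v2 · 0) + v1))))).

Lemma row_spec G (H : list (fm G)) s k m :
  teq H (row · s · k · m) (s · (1 + (m * (s · 0) + k))).
Proof. unfold row. rewrite beta, !beta_sub. reflexivity. Qed.

Lemma teq_fun G (H : list (fm G)) s t (f g : tm G (s ⇒ t)) :
  teq (map wk_fm H) (wk f · v0) (wk g · v0) -> teq H f g.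
Proof. apply PAllI. Qed.

Lemma row_pairseq_0 G (H : list (fm G)) f g : teq H f (row · (pairseq · f · g) · 0).
Proof.
  apply teq_fun. name_hyps K.
  change (teq K (wk f · v0) (row · (pairseq · wk f · wk g) · 0 · v0)).
  pose proof (parity_even K v0) as p. pose proof (half_even K v0) as h.
  rewrite row_spec, pairseq_0, teq_add0, teq_addC, pairseq_S, h.
  now rewrite cnd_0.
Qed.

Lemma row_pairseq_1 G (H : list (fm G)) f g : teq H g (row · (pairseq · f · g) · 1).
Proof.
  apply teq_fun. name_hyps K.
  change (teq K (wk g · v0) (row · (pairseq · wk f · wk g) · 1 · v0)).
  pose proof (parity_even K v0) as p. pose proof (half_even K v0) as h.
  rewrite row_spec, pairseq_0, (teq_addC K 1 (_ + 1)), pairseq_S, half_S, h, p, teq_add0.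
  rewrite cnd_S; [reflexivity|].
  now rewrite parity_succ_even, teq_add0l.
Qed.

Lemma seq1_pairseq G (H : list (fm G)) f g : H ⊢ seq1 (pairseq · f · g).
Proof.
  apply PImpI, succ_neq_0 with 1. name_hyps K.
  rewrite <- (pairseq_0 K f g). hyp.
Qed.

Lemma sub_mem1 G D j s (e : sub G D) :
  sub_fm (mem1 j s) e = mem1 (sub_tm e j) (sub_tm e s).
Proof. unfold mem1. now norm. Qed.

(** Membership in a coded sequence, as equality at type 1 with one of its rows. *)
Lemma mem1_intro G (H : list (fm G)) j s k :
  H ⊢ k ≺ s · 0 -> teq H j (row · s · k) -> H ⊢ mem1 j s.
Proof.
  intros h e. apply ex_intro with (a := k)
    (B := (k ≺ s · 0 ⊓ All N (wk j · v0 ≐ wk s · (1 + (v0 * (wk s · 0) + wk k))))).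
  2: { now norm. }
  apply PAndI; [exact h|].
  apply cut with (1 := e), PAllI.
  change (teq (map wk_fm (eqty j (row · s · k) :: H)) (wk j · v0)
            (wk s · (1 + (v0 * (wk s · 0) + wk k)))).
  rewrite <- row_spec. apply teq_app_l. apply PHyp; left. apply wk_eqty.
Qed.

Lemma mem1_elim G (H : list (fm G)) j s C :
  H ⊢ mem1 j s ->
  eqty (wk j) (row · wk s · v0) :: (v0 ≺ wk s · 0) :: map wk_fm H ⊢ wk_fm C ->
  H ⊢ C.
Proof.
  intros h k. eapply PExE; [exact h|].
  set (M := _ ⊓ _).
  apply cut with (v0 ≺ wk s · 0); [eapply PAndE1; apply PHyp; now left|].
  apply cut with (eqty (wk j) (row · wk s · v0)).
  - assert (a : (v0 ≺ wk s · 0) :: M :: map wk_fm H ⊢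
      All N (wk (wk j) · v0 ≐ wk (wk s) · (1 + (v0 * (wk (wk s) · 0) + v1))))
      by (eapply PAndE2; apply PHyp; right; now left).
    eapply cut; [exact a|]. apply teq_fun.
    change (teq (map wk_fm (All N (wk (wk j) · v0 ≐ wk (wk s) · (1 + (v0 * (wk (wk s) · 0) + v1))) :: (v0 ≺ wk s · 0) :: M :: map wk_fm H))
      (wk (wk j) · v0) (row · wk (wk s) · v1 · v0)).
    rewrite row_spec.
    eapply all_elim with (a := v0); [apply PHyp; now left|].
    norm. reflexivity.
  - apply (weaken_incl k). reassume.
Qed.

Lemma mem0_intro G (H : list (fm G)) m c l a b k q :
  teq H c (pair0 l (pair0 a b)) -> H ⊢ k ≺ l ->
  teq H a (q * (1 + (k + 1) * b) + m) -> H ⊢ m ≺ 1 + (k + 1) * b ->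
  H ⊢ mem0 m c.
Proof.
  intros hc hk ha hm. unfold mem0.
  eapply ex_intro with (a := l); [|reflexivity].
  eapply ex_intro with (a := a); [|reflexivity].
  eapply ex_intro with (a := b); [|reflexivity].
  norm. apply PAndI; [exact hc|].
  eapply ex_intro with (a := k); [|reflexivity].
  norm. apply PAndI; [exact hk|].
  eapply ex_intro with (a := q); [|reflexivity].
  norm. apply PAndI; [exact ha|exact hm].
Qed.

(** With [b = 1] the moduli are [2] and [3], and [4] is [0] modulo [2] and [1]
    modulo [3]. *)
Definition bits {G} : tm G N := pair0 (1 + 1) (pair0 (1 + 1 + 1 + 1) 1).

Lemma mem0_bits_0 G (H : list (fm G)) m c :
  teq H c bits -> teq H m 0 -> H ⊢ mem0 m c.
Proof.
  intros hc hm.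
  assert (t : teq H (1 + (0 + 1) * 1) (1 + 1)) by now rewrite teq_mul1, teq_add0l.
  apply mem0_intro with (l := 1 + 1) (a := 1 + 1 + 1 + 1) (b := 1) (k := 0) (q := 1 + 1).
  - exact hc.
  - apply lt_trans with 1; [apply PAx, ax_lt_01|apply lt_succ].
  - now rewrite t, hm, teq_add0, teq_mul2, teq_addA.
  - rewrite t, hm. apply lt_trans with (1); [apply PAx, ax_lt_01|apply lt_succ].
Qed.

Lemma mem0_bits_1 G (H : list (fm G)) m c :
  teq H c bits -> teq H m 1 -> H ⊢ mem0 m c.
Proof.
  intros hc hm.
  assert (t : teq H (1 + (1 + 1) * 1) (1 + 1 + 1))
    by now rewrite teq_mul1, teq_addA.
  apply mem0_intro with (l := 1 + 1) (a := 1 + 1 + 1 + 1) (b := 1) (k := 1) (q := 1).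
  - exact hc.
  - apply lt_succ.
  - now rewrite t, hm, teq_mulC, teq_mul1.
  - rewrite t, hm. apply lt_trans with (1 + 1); apply lt_succ.
Qed.

(** * The choice functions *)

Definition test {G} : tm G (ty2 ⇒ ty1 ⇒ N ⇒ ty1) :=
  lam (lam (lam (lam (v3 · pair10 (row · v2 · v0) v1)))).

Lemma test_spec G (H : list (fm G)) Y J n k :
  teq H (test · Y · J · n · k) (Y · pair10 (row · J · k) n).
Proof. unfold test. rewrite beta, !beta_sub. reflexivity. Qed.

(** The choice function [F_J], with value [1] at [i] if the row of [J] found by the
    search is a witness for the number [i(0)].  For the empty sequence the search
    returns [0] and the row tested, the zero function, is not an entry; it is
    still a witness if the value is [1]. *)
Definition fam {G} : tm G (ty2 ⇒ ty1 ⇒ ty2) :=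
  lam (lam (lam (
    cnd · (test · v2 · v1 · (v0 · 0)
            · (search · (test · v2 · v1 · (v0 · 0)) · (v1 · 0))) · 1 · 0))).

(** The number of an entry of [J] which is a witness for [n], if there is one, and
    otherwise [0]. *)
Definition hit {G} (Y : tm G ty2) (J : tm G ty1) (n : tm G N) : tm G N :=
  search · (test · Y · J · n) · (J · 0).

Lemma fam_spec G (H : list (fm G)) Y J i :
  teq H (fam · Y · J · i)
    (cnd · (Y · pair10 (row · J · hit Y J (i · 0)) (i · 0)) · 1 · 0).
Proof.
  unfold fam. rewrite beta, !beta_sub.
  rewrite <- test_spec. reflexivity.
Qed.

(** If the value is [1], the row found by the search is an explicit witness. *)
Lemma fam_cases G (H : list (fm G)) Y J i C :
  (Y · pair10 (row · J · hit Y J (i · 0)) (i · 0) ≐ 0) :: (fam · Y · J · i ≐ 1) :: H ⊢ C ->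
  (fam · Y · J · i ≐ 0) :: H ⊢ C -> H ⊢ C.
Proof.
  intros h k.
  apply nat_cases with (Y · pair10 (row · J · hit Y J (i · 0)) (i · 0)).
  - apply cut with (fam · Y · J · i ≐ 1).
    + rewrite fam_spec, cnd_0; [apply PAx, ax_refl|hyp].
    + apply (weaken_incl h). reassume.
  - apply cut with (fam · Y · J · i ≐ 0).
    + rewrite fam_spec, cnd_S; [apply PAx, ax_refl|hyp].
    + apply (weaken_incl k). reassume.
Qed.

#[export] Instance pair10_proper G (H : list (fm G)) :
  Proper (@teq G H ty1 ==> @teq G H N ==> @teq G H ty1) (@pair10 G).
Proof. intros f g h n m k. unfold pair10. now rewrite h, k. Qed.

(** The assumption [mem1 f J] gives a row of [J] that is equal to [f] at type 1; by
    extensionality [Y] cannot distinguish it from [f], so the search succeeds. *)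
Lemma fam_mem1 G (H : list (fm G)) Y J f i :
  H ⊢ mem1 f J -> teq H (Y · pair10 f (i · 0)) 0 -> teq H (fam · Y · J · i) 1.
Proof.
  intros h z. apply cut with (1 := z).
  eapply mem1_elim; [apply weaken, h|]. norm. name_hyps K.
  assert (e : teq K (wk f) (row · wk J · v0)) by hyp.
  assert (z' : teq K (wk Y · pair10 (wk f) (wk i · 0)) 0) by hyp.
  change (teq K (fam · wk Y · wk J · wk i) 1).
  rewrite fam_spec, cnd_0; [reflexivity|].
  unfold hit. rewrite <- test_spec.
  apply search_spec with v0; [hyp|].
  rewrite test_spec, <- e. exact z'.
Qed.

(** * Compactness *)

(** The conclusion of the Rado principle about [F], for the choice functions [fam]
    obtained from [Y]. *)
Definition compatible {G} (Y F : tm G ty2) : fm G :=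
  All1s (Ex1s (subset1 v1 v0 ⊓
    All ty1 (mem1 v0 v2 ⊃
      wk (wk (wk F)) · v0 ≐ fam · wk (wk (wk Y)) · v1 · v0))).

(** Compatibility is only ever used for the two-element sets [{i, f}]: [i] is where
    [F] is evaluated, and [f] is a possible witness that [K] must contain. *)
Lemma compatible_two G (H : list (fm G)) Y F f i : H ⊢ compatible Y F ->
  H ⊢ Ex ty1 (mem1 (wk f) v0 ⊓ wk F · wk i ≐ fam · wk Y · v0 · wk i).
Proof.
  intros h.
  assert (m0 : forall D (K : list (fm D)) i f, K ⊢ mem1 i (pairseq · i · f)).
  { intros D K a b. apply mem1_intro with 0; [|apply row_pairseq_0].
    rewrite pairseq_0. apply lt_trans with 1; [apply PAx, ax_lt_01|apply lt_succ]. }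
  assert (m1 : forall D (K : list (fm D)) i f, K ⊢ mem1 f (pairseq · i · f)).
  { intros D K a b. apply mem1_intro with 1; [|apply row_pairseq_1].
    rewrite pairseq_0. apply lt_succ. }
  eapply PExE.
  - eapply PImpE; [eapply all_elim with (a := pairseq · i · f); [exact h|reflexivity]|].
    apply seq1_pairseq.
  - cbn [sub_fm]. set (S := _ ⊓ _). name_hyps K.
    assert (hs : K ⊢ S) by (apply PHyp; now left).
    unfold S, seq1, subset1 in hs. cbn [sub_fm] in hs.
    rewrite ?sub_mem1 in hs.
    apply PAndE2 in hs.
    eapply ex_intro with (a := v0); [|reflexivity].
    norm. rewrite sub_mem1. norm.
    apply PAndI.
    + apply PAndE1 in hs. eapply PImpE.
      * eapply all_elim with (a := wk f); [exact hs|]. norm. rewrite !sub_mem1. norm. reflexivity.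
      * apply m1.
    + apply PAndE2 in hs. eapply PImpE.
      * eapply all_elim with (a := wk i); [exact hs|]. norm. rewrite !sub_mem1. norm. reflexivity.
      * apply m0.
Qed.

(** * Comprehension *)

(** The function [n |-> F(c_n)], where [c_n] is the constant function [n]. *)
Definition on_constants {G} (F : tm G ty2) : tm G ty1 :=
  Sigma N ty1 N · (Pi ty2 N · F) · Pi N N.

Lemma on_constants_spec G (H : list (fm G)) F n : teq H (on_constants F · n) (F · (Pi N N · n)).
Proof. unfold on_constants. now rewrite teq_Sigma, teq_Pi. Qed.

Lemma on_constants_1 G (H : list (fm G)) Y F f n : H ⊢ compatible Y F ->
  teq H (Y · pair10 f n) 0 -> teq H (on_constants F · n) 1.
Proof.
  intros h z. rewrite on_constants_spec. apply cut with (1 := z).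
  eapply PExE; [apply weaken; exact (compatible_two f (Pi N N · n) h)|].
  cbn [map]. norm. name_hyps K.
  assert (m : K ⊢ mem1 (wk f) v0) by (eapply PAndE1; apply PHyp; now left).
  assert (e : teq K (wk F · (Pi N N · wk n)) (fam · wk Y · v0 · (Pi N N · wk n)))
    by (eapply PAndE2; apply PHyp; now left).
  assert (z' : teq K (wk Y · pair10 (wk f) (wk n)) 0) by hyp.
  change (teq K (wk F · (Pi N N · wk n)) 1).
  rewrite e. apply fam_mem1 with (1 := m).
  now rewrite teq_Pi.
Qed.

(** At [c_n] the function [F] agrees with some [fam Y K], whose only values are [0]
    and [1], and whose value [1] comes with a witness. *)
Lemma on_constants_cases G (H : list (fm G)) Y F n : H ⊢ compatible Y F ->
  H ⊢ on_constants F · n ≐ 0 ⊔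
      (on_constants F · n ≐ 1 ⊓ Ex ty1 (wk Y · pair10 v0 (wk n) ≐ 0)).
Proof.
  intros h.
  (* No particular witness has to be in [K], so the second element is arbitrary. *)
  eapply PExE; [exact (compatible_two (Pi N N · n) (Pi N N · n) h)|].
  norm. name_hyps K.
  assert (e : teq K (wk F · (Pi N N · wk n)) (fam · wk Y · v0 · (Pi N N · wk n)))
    by (eapply PAndE2; apply PHyp; now left).
  apply fam_cases with (wk Y) v0 (Pi N N · wk n).
  - apply POrI2, PAndI; name_hyps K'.
    + change (K' ⊢ on_constants (wk F) · wk n ≐ 1).
      assert (e' : teq K' (wk F · (Pi N N · wk n)) (fam · wk Y · v0 · (Pi N N · wk n))) by hyp.
      assert (o : teq K' (fam · wk Y · v0 · (Pi N N · wk n)) 1) by hyp.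
      rewrite (on_constants_spec K'), e'. exact o.
    + assert (z : teq K' (wk Y · pair10 (row · v0 · hit (wk Y) v0 (Pi N N · wk n · 0)) (Pi N N · wk n · 0)) 0) by hyp.
      eapply ex_intro with (a := row · v0 · hit (wk Y) v0 (Pi N N · wk n · 0)).
      2: { norm. cbn. unfold pair10. norm. reflexivity. }
      rewrite <- (teq_Pi K' (wk n) 0) at 2.
      exact z.
  - apply POrI1; name_hyps K'.
    change (K' ⊢ on_constants (wk F) · wk n ≐ 0).
    assert (e' : teq K' (wk F · (Pi N N · wk n)) (fam · wk Y · v0 · (Pi N N · wk n))) by hyp.
    assert (o : teq K' (fam · wk Y · v0 · (Pi N N · wk n)) 0) by hyp.
    rewrite (on_constants_spec K'), e'. exact o.
Qed.

Lemma fam_choice G (H : list (fm G)) Y J j c :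
  teq H c bits -> H ⊢ mem0 (fam · Y · J · j) c.
Proof.
  intros e. apply fam_cases with Y J j.
  - apply mem0_bits_1; [now do 2 apply weaken|hyp].
  - apply mem0_bits_0; [now apply weaken|hyp].
Qed.

Theorem theorem3p23 : provable RCA0omega (Imp Rado BOOT).
Proof.
  apply PImpI, PAllI. cbn [map].
  assert (r : [wk_fm Rado] ⊢
      All ty1 (Ex N (mem0 v0 (Pi N ty1 · bits · v1))) ⊃
      All1s (All ty1 (mem1 v0 v1 ⊃
        mem0 (fam · v2 · v1 · v0) (Pi N ty1 · bits · v0))) ⊃
      Ex ty2 (All ty1 (mem0 (v1 · v0) (Pi N ty1 · bits · v0)) ⊓ compatible v1 v0)).
  { eapply all_elim with (a := fam · v0);
      [eapply all_elim with (a := Pi N ty1 · bits); [apply PHyp; now left|]|];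
      reflexivity. }
  eapply PExE; [eapply PImpE; [eapply PImpE; [exact r|]|]|].
  - apply PAllI.
    apply ex_intro with (a := 0) (B := mem0 0 (Pi N ty1 · bits · v0)); [|reflexivity].
    apply mem0_bits_0; [apply teq_Pi|apply teq_refl].
  - apply PAllI, PImpI, PAllI, PImpI.
    apply (@fam_choice _ _ v2 v1 v0), teq_Pi.
  - name_hyps K.
    assert (h : K ⊢ compatible v1 v0) by (eapply PAndE2; apply PHyp; now left).
    clearbody K.
    apply ex_intro with (a := on_constants v0)
      (B := All N (on_constants v1 · v0 ≐ 0 ⊔ on_constants v1 · v0 ≐ 1) ⊓
            All N (Iff (on_constants v1 · v0 ≐ 1) (Ex ty1 (v3 · pair10 v0 v1 ≐ 0)))); [|reflexivity].
    apply cut with (1 := h).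
    apply PAndI; apply PAllI; cbn [map]; name_hyps L;
      assert (h' : L ⊢ compatible v2 v1) by (apply PHyp; now left).
    + eapply POrE; [exact (on_constants_cases v0 h')| |].
      * apply POrI1; hyp.
      * apply POrI2; eapply PAndE1; hyp.
    + apply PAndI; apply PImpI.
      * eapply POrE; [apply weaken, (on_constants_cases v0 h')| |].
        -- name_hyps M.
           assert (z : teq M (on_constants v1 · v0) 0) by hyp.
           assert (o : teq M (on_constants v1 · v0) 1) by hyp.
           apply not_lt_0 with 0. rewrite z in o. rewrite o at 2. apply PAx, ax_lt_01.
        -- eapply PAndE2; hyp.
      * eapply PExE; [apply PHyp; now left|].
        apply (@on_constants_1 _ _ v3 v2 v0 v1); [|hyp].
        apply PHyp; do 2 right; now left.
Qed.
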